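(* Let $C$ be a constant such that $|f(x)-B_N(f,x)|\le C\,\omega_{[0,1]}\big(f,\sqrt{x(1-x)/N}\big)$ for all $f\in C[0,1]$, all $N\ge1$ and all $x\in[0,1]$, where $B_N(f,x)=\sum_{i=0}^N\binom Ni x^i(1-x)^{N-i}f(i/N)$. Let $F:[0,1]\to K(\mathbb R^n)$ be continuous and of bounded variation (with respect to the Hausdorff distance). Then for all $N\ge1$ and $x\in[0,1]$, $$\mathrm{haus}\big(B^M_N(F,x),F(x)\big)\le 2\,\omega_{[0,1]}(F,1/N)+5C\,\omega_{[0,1]}\Big(v_F,\sqrt{x(1-x)/N}\Big).$$
   Context: $K(\mathbb R^n)$ is the collection of all nonempty compact subsets of $\mathbb R^n$, $|\cdot|$ is the Euclidean norm, $\mathrm{dist}(a,B)=\inf_{b\in B}|a-b|$, and $\mathrm{haus}(A,B)=\max\{\sup_{a\in A}\mathrm{dist}(a,B),\sup_{b\in B}\mathrm{dist}(b,A)\}$ is the Hausdorff distance. $\Pi_B(a)=\{b\in B:|a-b|=\mathrm{dist}(a,B)\}$. For $f:[0,1]\to X$ with values in a metric space $(X,\rho)$ (usual distance for real-valued functions, Hausdorff distance for $X=K(\mathbb R^n)$), $\omega_{[0,1]}(f,\delta)=\sup\{\rho(f(x),f(y)):|x-y|\le\delta,\ x,y\in[0,1]\}$ (so $\omega_{[0,1]}(f,0)=0$). The total variation $V_0^x(f)$ of $f$ on $[0,x]$ is the supremum of $\sum_{i=1}^{M}\rho(f(t_i),f(t_{i-1}))$ over all finite $t_0<\dots<t_M$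 in $[0,x]$; $f$ is of bounded variation if $V_0^1(f)<\infty$, and then $v_f(x)=V_0^x(f)$, $x\in[0,1]$. It is a known classical result that a constant $C$ as in the claim exists (independent of $f$). A metric chain of a finite sequence of compact sets $\{A_0,\dots,A_N\}$ is a vector $(a_0,\dots,a_N)$ with $a_i\in A_i$ for all $i$, for which there is $j$, $0\le j\le N$, such that $a_{i-1}\in\Pi_{A_{i-1}}(a_i)$ for $1\le i\le j$ and $a_{i+1}\in\Pi_{A_{i+1}}(a_i)$ for $j\le i\le N-1$. $CH(A_0,\dots,A_N)$ denotes the set of all metric chains. The metric Bernstein operator is $$B^M_N(F,x)=\Big\{\sum_{i=0}^N\binom Ni x^i(1-x)^{N-i}f_i:\ (f_0,\dots,f_N)\in CH\big(F(0),F(1/N),\dots,F(1)\big)\Big\}.$$ *)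

(* Defs.v *)
From HB Require Import structures.
From mathcomp Require Import all_boot all_order all_algebra.
From mathcomp Require Import all_classical all_reals all_analysis.

Set Implicit Arguments.
Unset Strict Implicit.
Unset Printing Implicit Defensive.

Import Order.TTheory GRing.Theory Num.Theory.
Import numFieldNormedType.Exports.

Local Open Scope classical_set_scope.
Local Open Scope ring_scope.

Section Euclidean.
Context {R : realType} {n : nat}.

(* The norm `|u| that the library puts on 'rV[R]_n is the sup norm; it induces
   the same topology, hence the same compact sets, as the Euclidean norm. *)
Definition enorm (u : 'rV[R]_n) : R := Num.sqrt (\sum_(i < n) u 0 i ^+ 2).

Definition edistance (u v : 'rV[R]_n) : R := enorm (u - v).

Definition dist (a : 'rV[R]_n) (B : set 'rV[R]_n) : R :=
  inf [set edistance a b | b in B].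

Definition haus (A B : set 'rV[R]_n) : R :=
  Num.max (sup [set dist a B | a in A]) (sup [set dist b A | b in B]).

Definition proj (B : set 'rV[R]_n) (a : 'rV[R]_n) : set 'rV[R]_n :=
  [set b | B b /\ edistance a b = dist a B].

End Euclidean.

Section MetricValued.
Context {R : realType} {X : Type}.
Implicit Types (rho : X -> X -> R) (f : R -> X).

(* A real-valued supremum, equal to 0 on unbounded sets; it is the intended one
   for functions f that are bounded on [0, 1]. *)
Definition modulus rho f (delta : R) : R :=
  sup [set r | exists x y : R,
    [/\ 0 <= x <= 1, 0 <= y <= 1, `|x - y| <= delta & r = rho (f x) (f y)]].

Definition total_var rho f (x : R) : \bar R :=
  ereal_sup [set s | exists (M : nat) (t : nat -> R),
    [/\ forall i, (i <= M)%N -> 0 <= t i <= x,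
        forall i, (i < M)%N -> t i < t i.+1 &
        s = (\sum_(1 <= i < M.+1) rho (f (t i)) (f (t i.-1)))%:E]].

Definition bounded_var rho f : Prop := (total_var rho f 1 < +oo)%E.

Definition var_fun rho f (x : R) : R := fine (total_var rho f x).

Definition continuous01 rho f : Prop :=
  forall x, 0 <= x <= 1 -> forall e, 0 < e -> exists2 d, 0 < d &
    forall y, 0 <= y <= 1 -> `|x - y| < d -> rho (f x) (f y) < e.

End MetricValued.

Definition rdist {R : realType} (u v : R) : R := `|u - v|.

Definition bernstein_basis {R : realType} (N i : nat) (x : R) : R :=
  'C(N, i)%:R * x ^+ i * (1 - x) ^+ (N - i).

Definition bernstein {R : realType} (N : nat) (f : R -> R) (x : R) : R :=
  \sum_(i < N.+1) bernstein_basis N i x * f (i%:R / N%:R).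

Section MetricChains.
Context {R : realType} {n : nat}.

(* The indices i and k = i + 1 range over consecutive elements of {0, ..., N}. *)
Definition metric_chain (N : nat) (A : 'I_N.+1 -> set 'rV[R]_n)
    (a : 'I_N.+1 -> 'rV[R]_n) : Prop :=
  (forall i, A i (a i)) /\
  exists j : 'I_N.+1, forall i k : 'I_N.+1, k = i.+1 :> nat ->
    ((k <= j)%N -> proj (A i) (a k) (a i)) /\
    ((j <= i)%N -> proj (A k) (a i) (a k)).

Definition metric_chains (N : nat) (A : 'I_N.+1 -> set 'rV[R]_n) :
    set ('I_N.+1 -> 'rV[R]_n) :=
  [set a | metric_chain A a].

Definition metric_bernstein (N : nat) (F : R -> set 'rV[R]_n) (x : R) :
    set 'rV[R]_n :=
  [set \sum_(i < N.+1) bernstein_basis N i x *: f i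
     | f in metric_chains (fun i : 'I_N.+1 => F (i%:R / N%:R))].

End MetricChains.

(* Main.v *)
Require Import Defs.
From mathcomp Require Import all_boot all_order all_algebra.
From mathcomp Require Import all_classical all_reals all_analysis.
From mathcomp Require Import ring lra.
Import Order.TTheory GRing.Theory Num.Theory.
Import numFieldNormedType.Exports.
Local Open Scope classical_set_scope.
Local Open Scope ring_scope.

(** Choose [k < N] with [k/N <= x <= (k+1)/N].  Every metric chain
    [(f_0, .., f_N)] of the sets [F (i/N)] gives a piecewise linear curve [s]
    through the points [f_i] at the nodes [i/N], and the corresponding point
    [e] of the metric Bernstein set is the vector-valued Bernstein polynomial
    of [s] at [x].  Two facts make [e] close to [f_k].

    - [s x] lies on the segment from [f_k] to [f_{k+1}].  Consecutive points of
      a chain are nearest points of one another's set in one of the two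
      directions, so this segment is at most as long as the Hausdorff distance
      of neighbouring sets, hence at most the modulus of [F] at [1/N]
      (lemma [metric_chain_step]).

    - The scalar Bernstein estimate, applied to the inner product of [s] with
      the error vector [u = s x - e], bounds [|u|] with the same constant [C],
      by Cauchy-Schwarz (lemma [bernstein_vector]).  The jumps
      [|f_{i+1} - f_i|] are at most the increments of the variation function
      [v_F] (lemma [var_fun_step]), so [s] oscillates at most as much as the
      piecewise linear interpolant of [v_F], and interpolation at equidistant
      nodes multiplies the oscillation of a nondecreasing function at any
      scale by at most 3 (lemma [polyline_osc_le]).

    Together (lemma [chain_node_bernstein]) [|f_k - e|] is at most one modulus
    of [F] plus the term in [v_F].  Since [x] is within [1/N] of [k/N], passing
    between [F (k/N)] and [F x] costs one more modulus of [F].  From a point of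
    the Bernstein set one goes to [f_k] and then projects onto [F x]; from a
    point of [F x] one projects onto [F (k/N)] and takes a chain through the
    projection, which exists because nearest points can be chosen successively
    to the left and to the right (lemma [metric_chain_through]). *)

(** * Euclidean inner product and norm *)

Definition edot {R : realType} {n : nat} (u v : 'rV[R]_n) : R :=
  \sum_(i < n) u 0 i * v 0 i.

Lemma enorm_ge0 (R : realType) (n : nat) (u : 'rV[R]_n) : 0 <= enorm u.
Proof. exact: sqrtr_ge0. Qed.

Lemma enorm_sqr (R : realType) (n : nat) (u : 'rV[R]_n) :
  enorm u ^+ 2 = edot u u.
Proof.
rewrite sqr_sqrtr; last by apply: sumr_ge0 => i _; exact: sqr_ge0.
by apply: eq_bigr => i _; rewrite expr2.
Qed.

Lemma edotDr (R : realType) (n : nat) (u v w : 'rV[R]_n) :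
  edot u (v + w) = edot u v + edot u w.
Proof. by rewrite -big_split; apply: eq_bigr => i _; rewrite mxE mulrDr. Qed.

Lemma edotZr (R : realType) (n : nat) (a : R) (u v : 'rV[R]_n) :
  edot u (a *: v) = a * edot u v.
Proof. by rewrite mulr_sumr; apply: eq_bigr => i _; rewrite mxE mulrCA. Qed.

Lemma edotNr (R : realType) (n : nat) (u v : 'rV[R]_n) :
  edot u (- v) = - edot u v.
Proof. by rewrite -scaleN1r edotZr mulN1r. Qed.

Lemma edotC (R : realType) (n : nat) (u v : 'rV[R]_n) : edot u v = edot v u.
Proof. by apply: eq_bigr => i _; rewrite mulrC. Qed.

Lemma edot_sumr (R : realType) (n m : nat) (b : 'I_m -> R)
    (f : 'I_m -> 'rV[R]_n) (u : 'rV[R]_n) :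
  edot u (\sum_(i < m) b i *: f i) = \sum_(i < m) b i * edot u (f i).
Proof.
have u0 : edot u 0 = 0 by rewrite -(scale0r 0) edotZr mul0r.
rewrite (big_morph _ (edotDr _ _ u) u0).
by apply: eq_bigr => i _; rewrite edotZr.
Qed.

(** Expanding the squared length of [|v|^2 u - <u,v> v] gives Cauchy-Schwarz
    without dividing by [|v|]. *)
Lemma edot_le (R : realType) (n : nat) (u v : 'rV[R]_n) :
  `|edot u v| <= enorm u * enorm v.
Proof.
rewrite -(@ler_pXn2r _ 2) ?nnegrE ?normr_ge0 ?mulr_ge0 ?enorm_ge0 //.
rewrite real_normK ?num_real // exprMn.
have [v0|v0] := eqVneq (enorm v) 0.
  have vi i : v 0 i = 0.
    have : edot v v = 0 by rewrite -enorm_sqr v0 expr0n.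
    move/eqP; rewrite psumr_eq0; last by move=> j _; rewrite -expr2 sqr_ge0.
    by move/allP/(_ i (mem_index_enum i)); rewrite /= mulf_eq0 orbb => /eqP.
  by rewrite /edot big1 ?v0 ?expr0n /= ?mulr0 // => i _; rewrite vi mulr0.
set w := enorm v ^+ 2 *: u - edot u v *: v.
have := sqr_ge0 (enorm w); rewrite enorm_sqr {2}/w edotDr edotNr !edotZr.
rewrite !(edotC _ _ w) /w !edotDr !edotNr !edotZr (edotC _ _ v u) -!enorm_sqr.
have := enorm_ge0 R n v; rewrite le_eqVlt eq_sym (negPf v0) /= => vgt0.
have v2 : 0 < enorm v ^+ 2 by rewrite exprn_gt0.
move=> H; rewrite -subr_ge0 -(pmulr_rge0 _ v2); apply: le_trans H _.
by rewrite le_eqVlt; apply/orP; left; apply/eqP; ring.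
Qed.

Lemma enormD (R : realType) (n : nat) (u v : 'rV[R]_n) :
  enorm (u + v) <= enorm u + enorm v.
Proof.
rewrite -(@ler_pXn2r _ 2) ?nnegrE ?addr_ge0 ?enorm_ge0 // enorm_sqr.
rewrite edotDr !(edotC _ _ (u + v)) !edotDr (edotC _ _ v u) -!enorm_sqr.
have := le_trans (ler_norm _) (edot_le R n u v); nra.
Qed.

Lemma enormZ (R : realType) (n : nat) (a : R) (u : 'rV[R]_n) :
  enorm (a *: u) = `|a| * enorm u.
Proof.
rewrite /enorm -sqrtr_sqr -sqrtrM ?sqr_ge0 // mulr_sumr.
by congr Num.sqrt; apply: eq_bigr => i _; rewrite mxE exprMn.
Qed.

Lemma edistanceC (R : realType) (n : nat) (u v : 'rV[R]_n) :
  edistance u v = edistance v u.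
Proof. by rewrite /edistance -opprB -scaleN1r enormZ normrN1 mul1r. Qed.

Lemma edistance_triangle (R : realType) (n : nat) (v u w : 'rV[R]_n) :
  edistance u w <= edistance u v + edistance v w.
Proof.
by apply: le_trans (enormD _ _ _ _); rewrite addrA subrK.
Qed.

Lemma edistance_ge0 (R : realType) (n : nat) (u v : 'rV[R]_n) :
  0 <= edistance u v.
Proof. exact: enorm_ge0. Qed.

Lemma continuous_sum (R : realType) (T : topologicalType) (m : nat)
    (f : 'I_m -> T -> R) :
  (forall i, continuous (f i)) -> continuous (fun x => \sum_(i < m) f i x).
Proof.
move=> cf x; apply: cvg_big => [|i _]; first exact: add_continuous.
exact: cf.
Qed.

Lemma edistance_continuous (R : realType) (n : nat) (a : 'rV[R]_n) :
  continuous (edistance a).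
Proof.
have cs : continuous (fun x : 'rV[R]_n => \sum_(i < n) (a - x) 0 i ^+ 2).
  apply: continuous_sum => i b.
  have -> : (fun x : 'rV[R]_n => (a - x) 0 i ^+ 2)
     = (fun x : 'rV[R]_n => (a 0 i - x 0 i) * (a 0 i - x 0 i)).
    by apply/funext => x; rewrite !mxE expr2.
  have ci : {for b, continuous (fun x : 'rV[R]_n => a 0 i - x 0 i)}.
    apply: (@continuousB _ _ _ (fun=> a 0 i) (fun x : 'rV[R]_n => x 0 i)).
      exact: cst_continuous.
    exact: coord_continuous.
  exact: (continuousM ci ci).
move=> b; apply: (@continuous_comp _ _ _
  (fun x : 'rV[R]_n => \sum_(i < n) (a - x) 0 i ^+ 2) Num.sqrt).
  exact: cs.
exact: sqrt_continuous.
Qed.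

(** * Distance to a set and Hausdorff distance *)

Lemma dist_le (R : realType) (n : nat) (a b : 'rV[R]_n) (B : set 'rV[R]_n) :
  B b -> dist a B <= edistance a b.
Proof.
move=> Bb; apply: ge_inf; last by exists b.
by exists 0 => _ [c _ <-]; exact: edistance_ge0.
Qed.

Lemma dist_ge0 (R : realType) (n : nat) (a : 'rV[R]_n) (B : set 'rV[R]_n) :
  B !=set0 -> 0 <= dist a B.
Proof.
move=> [b Bb]; apply: lb_le_inf; first by exists (edistance a b), b.
by move=> _ [c _ <-]; exact: edistance_ge0.
Qed.

Lemma proj_nonempty (R : realType) (n : nat) (B : set 'rV[R]_n) (a : 'rV[R]_n) :
  compact B -> B !=set0 -> Defs.proj B a !=set0.
Proof.
move=> cB B0.
have [|c cB' cmin] := @compact_EVT_min _ _ (edistance a) B B0 cB.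
  by apply: continuous_subspaceT; exact: edistance_continuous.
rewrite inE in cB'; exists c; split=> //; apply/eqP; rewrite eq_le dist_le //.
rewrite andbT; apply: lb_le_inf; first by exists (edistance a c), c.
by move=> _ [b Bb <-]; apply: cmin; rewrite inE.
Qed.

Lemma hausC (R : realType) (n : nat) (A B : set 'rV[R]_n) :
  haus A B = haus B A.
Proof. by rewrite /haus maxC. Qed.

(** Compactness of [A] is what makes the supremum defining the excess of [A]
    over [B] a genuine one. *)
Lemma dist_le_haus (R : realType) (n : nat) (A B : set 'rV[R]_n)
    (a : 'rV[R]_n) :
  compact A -> B !=set0 -> A a -> dist a B <= haus A B.
Proof.
move=> cA [b Bb] Aa; rewrite /haus le_max; apply/orP; left.
apply: ub_le_sup; last by exists a.
have [||c _ cmax] := @compact_EVT_max _ _ (edistance b) A _ cA.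
- by exists a.
- by apply: continuous_subspaceT; exact: edistance_continuous.
exists (edistance b c) => _ [d Ad <-]; apply: le_trans (dist_le _ _ d b B Bb) _.
by rewrite edistanceC; apply: cmax; rewrite inE.
Qed.

Lemma haus_le (R : realType) (n : nat) (A B : set 'rV[R]_n) (e : R) :
  A !=set0 -> B !=set0 ->
  (forall a, A a -> exists2 b, B b & edistance a b <= e) ->
  (forall b, B b -> exists2 a, A a & edistance b a <= e) ->
  haus A B <= e.
Proof.
move=> [a0 Aa0] [b0 Bb0] AB BA; rewrite /haus ge_max; apply/andP; split.
- apply: ge_sup; first by exists (dist a0 B), a0.
  move=> _ [a Aa <-]; have [b Bb] := AB a Aa.
  exact: le_trans (dist_le _ _ _ _ _ Bb).
- apply: ge_sup; first by exists (dist b0 A), b0.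
  move=> _ [a Aa <-]; have [b Bb] := BA a Aa.
  exact: le_trans (dist_le _ _ _ _ _ Bb).
Qed.

Lemma proj_haus (R : realType) (n : nat) (A B : set 'rV[R]_n)
    (a b : 'rV[R]_n) :
  compact A -> A a -> Defs.proj B a b -> edistance a b <= haus A B.
Proof.
by move=> cA Aa [Bb ->]; apply: dist_le_haus => //; exists b.
Qed.

Lemma hausxx (R : realType) (n : nat) (A : set 'rV[R]_n) :
  A !=set0 -> haus A A = 0.
Proof.
move=> A0; have [a Aa] := A0.
have dxx (b : 'rV[R]_n) : edistance b b = 0.
  by rewrite /edistance subrr -(scale0r (0 : 'rV_n)) enormZ normr0 mul0r.
have dA b : A b -> dist b A = 0.
  move=> Ab; apply/eqP; rewrite eq_le dist_ge0 // andbT.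
  by rewrite -(dxx b); apply: dist_le.
rewrite /haus maxxx (_ : [set _ | _ in _] = [set 0]) ?sup1 //.
apply/seteqP; split=> [_ [b Ab <-]|_ ->]; first exact: dA.
by exists a => //; exact: dA.
Qed.

(** * The variation function of a curve in a metric space *)

Section Variation.
Context {R : realType} {X : Type} (rho : X -> X -> R) (f : R -> X).

Lemma le_total_var (x y : R) : x <= y ->
  (total_var rho f x <= total_var rho f y)%E.
Proof.
move=> xy; apply: ereal_sup_le => _ [M [t [tx ti ->]]]; exists M, t; split=> //.
by move=> i /tx /andP[-> /= /le_trans]; exact.
Qed.

Lemma total_var_ge0 (x : R) : 0 <= x -> (0 <= total_var rho f x)%E.
Proof.
move=> x0; apply: ereal_sup_ubound; exists 0%N, (fun=> 0); split=> //.
- by move=> i _; rewrite lexx x0.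
- by rewrite big_geq.
Qed.

Hypothesis rho_ge0 : forall x y : R, 0 <= x <= 1 -> 0 <= y <= 1 ->
  0 <= rho (f x) (f y).
Hypothesis fbv : bounded_var rho f.

Lemma total_var_fin (x : R) : 0 <= x <= 1 -> (total_var rho f x) \is a fin_num.
Proof.
case/andP=> x0 x1; rewrite ge0_fin_numE ?total_var_ge0 //.
exact: le_lt_trans (le_total_var _ _ x1) fbv.
Qed.

Lemma var_fun_le (x y : R) : 0 <= x -> x <= y -> y <= 1 ->
  var_fun rho f x <= var_fun rho f y.
Proof.
move=> x0 xy y1; apply: fine_le; last exact: le_total_var.
- by apply: total_var_fin; rewrite x0 (le_trans xy).
- by apply: total_var_fin; rewrite (le_trans x0 xy).
Qed.

Definition append_node (M : nat) (t : nat -> R) (y : R) (i : nat) : R :=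
  if (i <= M)%N then t i else y.

Lemma append_node_sum (M : nat) (t : nat -> R) (y : R) :
  \sum_(1 <= i < M.+2) rho (f (append_node M t y i)) (f (append_node M t y i.-1))
  = \sum_(1 <= i < M.+1) rho (f (t i)) (f (t i.-1)) + rho (f y) (f (t M)).
Proof.
rewrite big_nat_recr //= /append_node leqnn ltnn; congr (_ + _).
apply: eq_big_nat => i /andP[i1]; rewrite ltnS => iM.
by rewrite iM (leq_trans (leq_pred i)).
Qed.

Lemma append_node_le (M : nat) (t : nat -> R) (y z : R) : 0 <= y <= z ->
  (forall i, (i <= M)%N -> 0 <= t i <= z) ->
  forall i, (i <= M.+1)%N -> 0 <= append_node M t y i <= z.
Proof. by move=> yz tz i _; rewrite /append_node; case: leqP => // /tz. Qed.

Lemma append_node_lt (M : nat) (t : nat -> R) (y : R) : t M < y ->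
  (forall i, (i < M)%N -> t i < t i.+1) ->
  forall i, (i < M.+1)%N -> append_node M t y i < append_node M t y i.+1.
Proof.
move=> tMy ti i; rewrite ltnS leq_eqVlt => /orP[/eqP ->|iM].
  by rewrite /append_node leqnn ltnn.
by rewrite /append_node iM ltnW // ti.
Qed.

(** A subdivision of [0, x] can be prolonged so as to end at [x], and then by
    the single step from [x] to [y]. *)
Lemma var_fun_step (x y : R) : 0 <= x -> x < y -> y <= 1 ->
  rho (f y) (f x) <= var_fun rho f y - var_fun rho f x.
Proof.
move=> x0 xy y1; have y0 := le_trans x0 (ltW xy).
have x1 := le_trans (ltW xy) y1.
rewrite lerBrDl -lerBrDr -lee_fin /var_fun fineK; last first.
  by apply: total_var_fin; rewrite x0 x1.
apply: ge_ereal_sup => _ [M [t [tx ti ->]]].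
rewrite lee_fin lerBrDr -lee_fin fineK; last first.
  by apply: total_var_fin; rewrite y0 y1.
have ub (K : nat) (s : nat -> R) : (forall i, (i <= K)%N -> 0 <= s i <= x) ->
    (forall i, (i < K)%N -> s i < s i.+1) -> s K = x ->
    ((\sum_(1 <= i < K.+1) rho (f (s i)) (f (s i.-1)) + rho (f y) (f x))%:E
      <= total_var rho f y)%E.
  move=> sx si sK; apply: ereal_sup_ubound.
  exists K.+1, (append_node K s y); split.
  - apply: append_node_le; first by rewrite y0 lexx.
    by move=> i /sx /andP[-> /= /le_trans]; apply; exact: ltW.
  - by apply: append_node_lt; rewrite ?sK.
  - by rewrite append_node_sum sK.
have /andP[tM0] := tx M (leqnn M).
rewrite le_eqVlt => /orP[/eqP tMx|tMx]; first exact: ub.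
apply: le_trans (ub M.+1 (append_node M t x) _ _ _).
- rewrite lee_fin lerD2r append_node_sum lerDl rho_ge0 //.
    by rewrite x0 x1.
  by rewrite tM0 (le_trans (ltW tMx)).
- by apply: append_node_le => //; rewrite x0 lexx.
- exact: append_node_lt.
- by rewrite /append_node ltnn.
Qed.

End Variation.

(** * Piecewise linear interpolation at equidistant nodes *)

Definition clamp01 {R : realType} (t : R) : R := Num.max 0 (Num.min 1 t).

(** The interpolant of the values [c i] at the nodes [i/N], written as one
    formula with a ramp for each interval: continuity is then inherited from
    the ramps, and the difference of two values is a combination of the
    increments [c i.+1 - c i] with nonnegative weights. *)
Definition polyline {R : realType} (N : nat) (c : nat -> R) (y : R) : R :=
  c 0%N + \sum_(i < N) (c i.+1 - c i) * clamp01 (N%:R * y - i%:R).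

Lemma clamp01_le (R : realType) (s t : R) : s <= t -> clamp01 s <= clamp01 t.
Proof. by move=> st; rewrite /clamp01 le_max2// le_min2. Qed.

Lemma clamp01_eq0 (R : realType) (t : R) : t <= 0 -> clamp01 t = 0.
Proof. by move=> t0; rewrite /clamp01 max_l // ge_min t0 orbT. Qed.

Lemma clamp01_eq1 (R : realType) (t : R) : 1 <= t -> clamp01 t = 1.
Proof. by move=> t1; rewrite /clamp01 min_l // max_r. Qed.

Lemma clamp01_id (R : realType) (t : R) : 0 <= t <= 1 -> clamp01 t = t.
Proof. by case/andP=> t0 t1; rewrite /clamp01 min_r // max_r. Qed.

Lemma clamp01_continuous (R : realType) : continuous (@clamp01 R).
Proof.
move=> x; apply: (@continuous_max _ _ (fun=> 0) (fun t : R => Num.min 1 t)).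
  exact: cst_continuous.
apply: (@continuous_min _ _ (fun=> 1) (fun t : R => t)).
  exact: cst_continuous.
exact: cvg_id.
Qed.

Lemma polyline_continuous (R : realType) (N : nat) (c : nat -> R) :
  continuous (polyline N c).
Proof.
have cs : continuous (fun y : R =>
    \sum_(i < N) (c i.+1 - c i) * clamp01 (N%:R * y - i%:R)).
  apply: continuous_sum => i y.
  apply: (@continuousM _ _ (fun=> c i.+1 - c i)
    (fun y : R => clamp01 (N%:R * y - i%:R))); first exact: cst_continuous.
  apply: (@continuous_comp _ _ _ (fun y : R => N%:R * y - i%:R) clamp01).
    apply: (@continuousB _ _ _ (fun y : R => N%:R * y) (fun=> i%:R)).
      exact: mulrl_continuous.
    exact: cst_continuous.
  exact: clamp01_continuous.
move=> y; apply: (@continuousD _ _ _ (fun=> c 0%N)); last exact: cs.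
exact: cst_continuous.
Qed.

Lemma polyline_segment (R : realType) (N : nat) (c : nat -> R) (k : nat)
    (y : R) : (k < N)%N -> k%:R <= N%:R * y <= k.+1%:R ->
  polyline N c y = c k + (N%:R * y - k%:R) * (c k.+1 - c k).
Proof.
move=> kN /andP[ky yk]; rewrite /polyline.
rewrite -(big_mkord xpredT
  (fun i => (c i.+1 - c i) * clamp01 (N%:R * y - i%:R))).
rewrite (@big_cat_nat _ _ _ k) //=; last exact: ltnW.
rewrite (@big_ltn _ _ _ k) //=.
have -> : \sum_(0 <= i < k) (c i.+1 - c i) * clamp01 (N%:R * y - i%:R)
          = c k - c 0%N.
  rewrite -(telescope_sumr c (leq0n k)); apply: eq_big_nat => i /andP[_ ik].
  rewrite clamp01_eq1 ?mulr1 // lerBrDr; apply: le_trans ky.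
  by rewrite nat1r ler_nat.
rewrite big_nat big1 => [|i /andP[ki _]]; last first.
  rewrite clamp01_eq0 ?mulr0 // subr_le0; apply: le_trans yk _.
  by rewrite ler_nat.
rewrite clamp01_id; last by rewrite -natr1 in yk; apply/andP; split; lra.
ring.
Qed.

(** The index is [floor (N y)], except that [y = 1] is assigned to the last
    interval. *)
Lemma between_nodes (R : realType) (N : nat) (y : R) : (1 <= N)%N ->
  0 <= y <= 1 -> exists2 k, (k < N)%N & k%:R <= N%:R * y <= k.+1%:R.
Proof.
move=> N1 /andP[y0 y1]; have Ny0 : 0 <= N%:R * y by rewrite mulr_ge0.
have /andP[ky yk] := truncn_itv Ny0.
have [kN|Nk] := ltnP (Num.truncn (N%:R * y)) N.
  by exists (Num.truncn (N%:R * y)); rewrite // ky ltW.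
have NyN : N%:R * y <= N%:R by rewrite ler_piMr.
exists N.-1; rewrite ?prednK // NyN andbT.
apply: le_trans ky; rewrite ler_nat; exact: leq_trans (leq_pred N) Nk.
Qed.

Lemma polyline_node (R : realType) (N : nat) (c : nat -> R) (k : nat) :
  (1 <= N)%N -> (k <= N)%N -> polyline N c (k%:R / N%:R) = c k.
Proof.
move=> N1 kN; have N0 : N%:R != 0 :> R by rewrite pnatr_eq0 -lt0n.
have E : N%:R * (k%:R / N%:R) = k%:R :> R by rewrite mulrC divfK.
move: kN; rewrite leq_eqVlt => /orP[/eqP kN|kN]; last first.
  have kE : (k%:R : R) <= N%:R * (k%:R / N%:R : R) <= (k.+1%:R : R).
    by rewrite E lexx ler_nat leqnSn.
  by rewrite (polyline_segment _ _ _ _ _ kN kE) E subrr mul0r addr0.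
have N1N : (N.-1 < N)%N by rewrite prednK.
have kE : (N.-1%:R : R) <= N%:R * (k%:R / N%:R : R) <= (N.-1.+1%:R : R).
  by rewrite E kN prednK // lexx ler_nat leq_pred.
rewrite (polyline_segment _ _ _ _ _ N1N kE) E kN prednK //.
rewrite -[in X in X - _](prednK N1) -natr1 (addrC _ 1) addrK mul1r.
by rewrite addrC subrK.
Qed.

(** The identity is its own interpolant, scaled by [N]: all its increments
    are 1. *)
Lemma sum_clamp01 (R : realType) (N : nat) (y : R) : (1 <= N)%N ->
  0 <= y <= 1 -> \sum_(i < N) clamp01 (N%:R * y - i%:R) = N%:R * y.
Proof.
move=> N1 y01; have [k kN ky] := between_nodes _ _ _ N1 y01.
have succB i : i.+1%:R - i%:R = 1 :> R by rewrite -natr1 addrAC subrr add0r.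
have := polyline_segment _ _ (fun i => i%:R) _ _ kN ky.
rewrite succB mulr1 addrC subrK => E; rewrite -[RHS]E.
rewrite /polyline add0r; apply: eq_bigr => i _.
by rewrite succB mul1r.
Qed.

(** The ramps are nondecreasing, so the weights of the increments in the
    difference are nonnegative and domination of increments passes to the
    interpolants. *)
Lemma polyline_diff_le (R : realType) (N : nat) (c d : nat -> R) (y z : R) :
  (forall i, (i < N)%N -> `|c i.+1 - c i| <= d i.+1 - d i) -> z <= y ->
  `|polyline N c y - polyline N c z| <= polyline N d y - polyline N d z.
Proof.
move=> cd zy.
have E (e : nat -> R) : polyline N e y - polyline N e z =
   \sum_(i < N) (e i.+1 - e i) *
     (clamp01 (N%:R * y - i%:R) - clamp01 (N%:R * z - i%:R)).
  rewrite /polyline opprD addrACA subrr add0r -sumrB.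
  by apply: eq_bigr => i _; rewrite mulrBr.
rewrite !E; apply: le_trans (ler_norm_sum _ _ _) _; apply: ler_sum => i _.
have cl : 0 <= clamp01 (N%:R * y - i%:R) - clamp01 (N%:R * z - i%:R).
  by rewrite subr_ge0 clamp01_le // lerD2r ler_wpM2l.
by rewrite normrM (ger0_norm cl) ler_wpM2r // cd.
Qed.

Section PolylineModulus.
Context {R : realType} (V : R -> R) (W delta : R).
Hypothesis V_mono : forall a b, 0 <= a -> a <= b -> b <= 1 -> V a <= V b.
Hypothesis V_osc : forall a b, 0 <= a -> a <= b -> b <= 1 ->
  b - a <= delta -> V b - V a <= W.
Hypothesis delta_ge0 : 0 <= delta.

Lemma osc_ge0 : 0 <= W.
Proof. by have := V_osc 0 0; rewrite !subrr; apply. Qed.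

(** Cutting [a, b] from the right into steps of length [delta]. *)
Lemma increment_le (m : nat) (a b : R) : 0 <= a -> a <= b -> b <= 1 ->
  b - a <= m%:R * delta -> V b - V a <= m%:R * W.
Proof.
move=> a0 ab b1; elim: m b ab b1 => [|m IH] b ab b1.
  rewrite mul0r subr_le0 => ba.
  by have -> : a = b by [apply: le_anti; rewrite ab ba]; rewrite subrr mul0r.
rewrite -natr1 !mulrDl !mul1r => bad; have W0 := osc_ge0; have d0 := delta_ge0.
have [|bd] := lerP (b - a) delta.
  by move/(V_osc _ _ a0 ab b1) => /le_trans; apply; rewrite lerDr mulr_ge0.
have : V (b - delta) - V a <= m%:R * W by apply: IH; lra.
have : V b - V (b - delta) <= W by apply: V_osc; lra.
lra.
Qed.

(** If [y - z >= 1/N], replace [z] and [y] by the nodes just outside: they are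
    at most [3 (y - z)] apart, so three steps suffice.  If [0 < w < 1] for
    [w = N (y - z)], the difference is at most [w] times the largest increment
    of [V] over an interval of length [1/N]; such an interval is covered by
    [m <= 1/w + 1] steps, which gives [w m W <= (1 + w) W <= 2 W]. *)
Lemma polyline_osc_le (N : nat) (y z : R) : (1 <= N)%N ->
  0 <= z -> z <= y -> y <= 1 -> y - z <= delta ->
  polyline N (fun i => V (i%:R / N%:R)) y
    - polyline N (fun i => V (i%:R / N%:R)) z <= 3 * W.
Proof.
move=> N1 z0 zy y1 yz; have W0 := osc_ge0.
have N0 : 0 < N%:R :> R by rewrite ltr0n.
have VS i : (i < N)%N -> V (i%:R / N%:R) <= V (i.+1%:R / N%:R).
  move=> iN; apply: V_mono.
  - by rewrite divr_ge0.
  - by rewrite ler_pM2r ?invr_gt0 // ler_nat.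
  - by rewrite ler_pdivrMr // mul1r ler_nat.
have y01 : 0 <= y <= 1 by rewrite y1 (le_trans z0).
have z01 : 0 <= z <= 1 by rewrite z0 (le_trans zy).
have [big|small] := lerP 1 (N%:R * (y - z)).
  have [k kN /andP[ky yk]] := between_nodes _ _ _ N1 y01.
  have [j jN /andP[jz zj]] := between_nodes _ _ _ N1 z01.
  rewrite (polyline_segment _ _ _ k) ?ky //.
  rewrite (polyline_segment _ _ _ j) ?jz //.
  have P3 : V (k.+1%:R / N%:R) - V (j%:R / N%:R) <= 3 * W.
    have jk : j%:R <= (k.+1%:R : R).
      by apply: le_trans jz (le_trans _ yk); rewrite ler_wpM2l.
    apply: (increment_le 3).
    - by rewrite divr_ge0.
    - by rewrite ler_pM2r ?invr_gt0.
    - by rewrite ler_pdivrMr // mul1r ler_nat.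
    - rewrite -mulrBl ler_pdivrMr // -natr1; rewrite -natr1 in zj.
      have : N%:R * (y - z) <= N%:R * delta by rewrite ler_wpM2l.
      move: big; rewrite !mulrBr; lra.
  have Dk := VS _ kN; have Dj := VS _ jN; rewrite -natr1 in yk.
  have : (N%:R * y - k%:R) * (V (k.+1%:R / N%:R) - V (k%:R / N%:R)) <=
     V (k.+1%:R / N%:R) - V (k%:R / N%:R).
    by rewrite ler_piMl ?subr_ge0 //; lra.
  have : 0 <= (N%:R * z - j%:R) * (V (j.+1%:R / N%:R) - V (j%:R / N%:R)).
    by rewrite mulr_ge0 ?subr_ge0.
  lra.
have [yz0|yz0] := eqVneq z y; first by rewrite yz0 subrr mulr_ge0.
have w0 : 0 < N%:R * (y - z) by rewrite mulr_gt0 // subr_gt0 lt_neqAle yz0.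
set w := N%:R * (y - z) in small w0 *.
have /andP[mlo mhi] := truncn_itv (ltW (divr_gt0 (@ltr01 R) w0)).
set m := Num.truncn (1 / w) in mlo mhi.
have VSW i : (i < N)%N -> V (i.+1%:R / N%:R) - V (i%:R / N%:R) <= m.+1%:R * W.
  move=> iN; apply: increment_le.
  - by rewrite divr_ge0.
  - by rewrite ler_pM2r ?invr_gt0 // ler_nat.
  - by rewrite ler_pdivrMr // mul1r ler_nat.
  - rewrite -mulrBl -natr1 (addrC i%:R) addrK ler_pdivrMr //.
    apply: le_trans (_ : m.+1%:R * w <= _).
      by rewrite -ler_pdivrMr // ltW.
    by rewrite -mulrA ler_wpM2l // /w mulrC ler_wpM2r // ltW.
apply: le_trans (_ : m.+1%:R * W * w <= _); last first.
  have mw : m%:R * w <= 1 by rewrite -ler_pdivlMr.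
  rewrite mulrAC ler_wpM2r // -natr1 mulrDl; lra.
have wE : w = \sum_(i < N) (clamp01 (N%:R * y - i%:R)
                            - clamp01 (N%:R * z - i%:R)).
  by rewrite sumrB !sum_clamp01 // /w mulrBr.
rewrite /polyline opprD addrACA subrr add0r -sumrB wE mulr_sumr.
apply: ler_sum => i _.
rewrite -mulrBr ler_wpM2r ?VSW // subr_ge0 clamp01_le //.
by rewrite lerD2r ler_wpM2l.
Qed.

End PolylineModulus.

(** * Moduli of continuity and the scalar Bernstein estimate *)

Section Modulus.
Context {R : realType} {X : Type} (rho : X -> X -> R) (f : R -> X) (M : R).
Hypothesis rho_bounded : forall x y : R, 0 <= x <= 1 -> 0 <= y <= 1 ->
  rho (f x) (f y) <= M.

(** Without a bound on the oscillation the supremum would be the junk value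
    0. *)
Lemma le_modulus (delta x y : R) : 0 <= x <= 1 -> 0 <= y <= 1 ->
  `|x - y| <= delta -> rho (f x) (f y) <= modulus rho f delta.
Proof.
move=> x01 y01 xy; apply: ub_le_sup; last by exists x, y.
by exists M => _ [a [b [a01 b01 _ ->]]]; exact: rho_bounded.
Qed.
End Modulus.

Lemma modulus_le (R : realType) (X : Type) (rho : X -> X -> R) (f : R -> X)
    (delta e : R) : 0 <= delta ->
  (forall x y : R, 0 <= x <= 1 -> 0 <= y <= 1 -> `|x - y| <= delta ->
    rho (f x) (f y) <= e) ->
  modulus rho f delta <= e.
Proof.
move=> d0 H; apply: ge_sup.
  by exists (rho (f 0) (f 0)), 0, 0; split; rewrite ?lexx ?ler01 ?subrr ?normr0.
by move=> _ [x [y [x01 y01 xy ->]]]; exact: H.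
Qed.

Definition bernstein_bound {R : realType} (C : R) : Prop :=
  forall f : R -> R, {within `[0, 1], continuous f} ->
    forall N : nat, (1 <= N)%N -> forall x : R, 0 <= x <= 1 ->
      `|f x - bernstein N f x|
        <= C * modulus rdist f (Num.sqrt (x * (1 - x) / N%:R)).

(** The identity has a positive modulus at positive scales; any instance of
    the estimate for it, here [N = 1] and [x = 1/2], forces the sign. *)
Lemma bernstein_bound_ge0 (R : realType) (C : R) : bernstein_bound C -> 0 <= C.
Proof.
move=> hC; set d := Num.sqrt (2^-1 * (1 - 2^-1) / 1%:R) : R.
have d0 : 0 < d by rewrite sqrtr_gt0; lra.
have d1 : d <= 1 by rewrite -[1]sqrtr1 ler_sqrt; lra.
have /(hC id) : {within `[0, 1], continuous (@id R)}.
  by apply: continuous_subspaceT; move=> ?; exact: cvg_id.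
move=> /(_ 1%N isT 2^-1) H.
have {H} : 0 <= C * modulus rdist (@id R) d.
  by apply: le_trans (normr_ge0 _) (H _); lra.
rewrite pmulr_lge0 //; apply: lt_le_trans d0 _.
have -> : d = rdist (id d) (id (0 : R)) by rewrite /rdist subr0 ger0_norm ?sqrtr_ge0.
apply: (@le_modulus _ _ _ _ 1).
- move=> x y /andP[x0 x1] /andP[y0 y1].
  by rewrite /rdist ler_norml; apply/andP; split; lra.
- by rewrite sqrtr_ge0 d1.
- by rewrite lexx ler01.
- by rewrite subr0 /rdist ger0_norm ?sqrtr_ge0 // subr0 ger0_norm ?sqrtr_ge0.
Qed.

(** Testing against the error vector [u] itself: the scalar function
    [<u, s>] has Bernstein error [<u, u> = |u|^2] at [x], while its modulus is
    at most [|u|] times that of the interpolant of [V].  Dividing by [|u|]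
    gives the estimate in Euclidean norm without losing a factor in the
    dimension. *)
Lemma bernstein_vector (R : realType) (n : nat) (C : R)
    (V : R -> R) (W : R) (N : nat) (x : R) (f : nat -> 'rV[R]_n) (k : nat) :
  bernstein_bound C -> (1 <= N)%N -> 0 <= x <= 1 ->
  (forall a b, 0 <= a -> a <= b -> b <= 1 -> V a <= V b) ->
  (forall a b, 0 <= a -> a <= b -> b <= 1 ->
     b - a <= Num.sqrt (x * (1 - x) / N%:R) -> V b - V a <= W) ->
  (forall i, (i < N)%N ->
     edistance (f i.+1) (f i) <= V (i.+1%:R / N%:R) - V (i%:R / N%:R)) ->
  (k < N)%N -> k%:R <= N%:R * x <= k.+1%:R ->
  edistance (f k + (N%:R * x - k%:R) *: (f k.+1 - f k))
            (\sum_(i < N.+1) bernstein_basis N i x *: f i) <= 3 * C * W.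
Proof.
move=> hC N1 x01 V_mono V_osc fV kN kx.
have C0 := bernstein_bound_ge0 _ _ hC.
set d := Num.sqrt _ in V_osc; have d0 : 0 <= d := sqrtr_ge0 _.
have W0 := osc_ge0 _ _ _ V_osc d0.
set p := f k + _; set e := \sum_(i < N.+1) _.
rewrite /edistance; set u := p - e.
have [->|u0] := eqVneq (enorm u) 0; first by rewrite !mulr_ge0.
have {}u0 : 0 < enorm u by rewrite lt_neqAle eq_sym u0 enorm_ge0.
pose c i := edot u (f i).
have : `|polyline N c x - bernstein N (polyline N c) x|
    <= C * modulus rdist (polyline N c) d.
  by apply: hC => //; apply: continuous_subspaceT; exact: polyline_continuous.
have -> : bernstein N (polyline N c) x = edot u e.
  rewrite edot_sumr; apply: eq_bigr => i _; rewrite polyline_node //.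
  by rewrite -ltnS.
have -> : polyline N c x = edot u p.
  by rewrite (polyline_segment _ _ _ _ _ kN kx) /p edotDr edotZr edotDr edotNr.
rewrite -edotNr -edotDr -/u -enorm_sqr ger0_norm ?exprn_ge0 ?enorm_ge0 // => H.
suff M : modulus rdist (polyline N c) d <= 3 * (enorm u * W).
  rewrite -(ler_pM2l u0) -expr2; apply: le_trans H _.
  apply: le_trans (ler_wpM2l C0 M) _.
  by rewrite le_eqVlt; apply/orP; left; apply/eqP; ring.
have osc y z : 0 <= z -> z <= y -> y <= 1 -> y - z <= d ->
    `|polyline N c y - polyline N c z| <= 3 * (enorm u * W).
  move=> z0 zy y1 yz.
  apply: le_trans (_ : polyline N (fun i => enorm u * V (i%:R / N%:R)) y -
    polyline N (fun i => enorm u * V (i%:R / N%:R)) z <= _).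
    apply: polyline_diff_le => // i iN.
    rewrite /c -edotNr -edotDr -mulrBr; apply: le_trans (edot_le _ _ _ _) _.
    by rewrite ler_wpM2l ?enorm_ge0 //; exact: fV.
  apply: (polyline_osc_le (fun t => enorm u * V t) _ d) => //.
  - by move=> a b a0 ab b1; rewrite ler_pM2l // V_mono.
  - by move=> a b a0 ab b1 abd; rewrite -mulrBr ler_pM2l // V_osc.
apply: modulus_le => // y z /andP[y0 y1] /andP[z0 z1] yz; rewrite /rdist.
have [zy|/ltW yz'] := lerP z y.
  by apply: osc => //; apply: le_trans (ler_norm _) yz.
rewrite distrC; apply: osc => //; apply: le_trans (ler_norm _) _.
by rewrite distrC.
Qed.

(** * Metric chains *)

Lemma metric_chain_step (R : realType) (n N : nat)
    (A : 'I_N.+1 -> set 'rV[R]_n) (a : 'I_N.+1 -> 'rV[R]_n) (i k : 'I_N.+1) :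
  (forall i, compact (A i)) -> metric_chain A a -> k = i.+1 :> nat ->
  edistance (a k) (a i) <= haus (A k) (A i).
Proof.
move=> cA [Aa [j aj]] ki; have [kj ji] := aj i k ki.
have [/kj p|] := leqP k j; first exact: proj_haus p.
rewrite ki ltnS => /ji p.
by rewrite edistanceC hausC; apply: proj_haus p.
Qed.

(** Starting from [p] at index [k], nearest points are chosen one after the
    other, to the right by [up] and to the left by [down]. *)
Lemma metric_chain_through (R : realType) (n N : nat)
    (A : nat -> set 'rV[R]_n) (k : nat) (p : 'rV[R]_n) : (k <= N)%N ->
  (forall i, (i <= N)%N -> compact (A i) /\ A i !=set0) -> A k p ->
  exists2 a : nat -> 'rV[R]_n,
    metric_chain (fun i : 'I_N.+1 => A i) (fun i => a i) & a k = p.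
Proof.
move=> kN cA Akp.
pose q i b := xget p (Defs.proj (A i) b).
have qP i b : (i <= N)%N -> Defs.proj (A i) b (q i b).
  by case/cA => ci A0; have [r pr] := proj_nonempty _ _ _ b ci A0; exact: xgetI pr.
pose up := fix up m := if m is m'.+1 then q (k + m)%N (up m') else p.
pose down := fix down m := if m is m'.+1 then q (k - m)%N (down m') else p.
pose a i := if (k <= i)%N then up (i - k)%N else down (k - i)%N.
have ak : a k = p by rewrite /a leqnn subnn.
have aup i : (k <= i)%N -> a i.+1 = q i.+1 (a i).
  move=> ki; rewrite /a ki (leq_trans ki) // subSn //= addnS subnKC //.
have adown i : (i < k)%N -> a i = q i (a i.+1).
  move=> ik; rewrite /a leqNgt ik /=.
  have -> /= : (k - i = (k - i.+1).+1)%N by rewrite subnSK.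
  have -> /= : (k - (k - i.+1).+1 = i)%N by rewrite subnSK // subKn // ltnW.
  case: leqP => // ki; have <- : i.+1 = k by apply/eqP; rewrite eqn_leq ik.
  by rewrite subnn.
exists a => //; split.
  move=> i; have iN : (i <= N)%N by rewrite -ltnS.
  have [ki|ki|<-] := ltngtP k i; last by rewrite ak.
  - case: (nat_of_ord i) ki iN => // m km mN; rewrite aup //.
    by have [] := qP m.+1 (a m) mN.
  - by rewrite (adown i ki); have [] := qP i (a i.+1) iN.
exists (inord k) => i l li; rewrite inordK // li; split.
  by move=> ik; rewrite [in X in Defs.proj _ _ X]adown //; apply: qP; rewrite -ltnS.
by move=> ki; rewrite aup //; apply: qP; rewrite -li -ltnS.
Qed.

(** * The Bernstein operator on set-valued functions *)

Lemma haus_ge0 (R : realType) (n : nat) (A B : set 'rV[R]_n) :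
  compact A -> A !=set0 -> B !=set0 -> 0 <= haus A B.
Proof.
move=> cA [a Aa] B0.
exact: le_trans (dist_ge0 _ _ a B B0) (dist_le_haus _ _ _ _ _ cA B0 Aa).
Qed.

Lemma node01 {R : realType} (N i : nat) : (1 <= N)%N -> (i <= N)%N -> 
  0 <= (i%:R / N%:R : R) <= 1.
Proof.
move=> N1 iN; have N0 : 0 < N%:R :> R by rewrite ltr0n.
by rewrite divr_ge0 //= ler_pdivrMr // mul1r ler_nat.
Qed.

Section SetValued.
Context {R : realType} {n : nat} (F : R -> set 'rV[R]_n).
Hypothesis F_nonempty : forall x : R, 0 <= x <= 1 -> F x !=set0.
Hypothesis F_compact : forall x : R, 0 <= x <= 1 -> compact (F x).
Hypothesis F_bv : bounded_var haus F.

Let haus_F_ge0 (x y : R) : 0 <= x <= 1 -> 0 <= y <= 1 -> 0 <= haus (F x) (F y).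
Proof. by move=> x01 y01; apply: haus_ge0; auto. Qed.

Lemma var_haus_ge0 (x : R) : 0 <= x -> 0 <= var_fun haus F x.
Proof. by move=> x0; rewrite fine_ge0 // total_var_ge0. Qed.

Lemma haus_le_var_diff (x y : R) : 0 <= x -> x <= y -> y <= 1 ->
  haus (F y) (F x) <= var_fun haus F y - var_fun haus F x.
Proof.
move=> x0; rewrite le_eqVlt => /orP[/eqP <- x1|xy y1].
  by rewrite hausxx ?subrr //; apply: F_nonempty; rewrite x0.
exact: (var_fun_step _ _ haus_F_ge0 F_bv).
Qed.

Lemma haus_le_var1 (x y : R) : 0 <= x <= 1 -> 0 <= y <= 1 ->
  haus (F x) (F y) <= var_fun haus F 1.
Proof.
have lt (a b : R) : 0 <= a -> a <= b -> b <= 1 ->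
    haus (F b) (F a) <= var_fun haus F 1.
  move=> a0 ab b1; have := haus_le_var_diff a b a0 ab b1.
  have := var_fun_le _ _ F_bv b 1 (le_trans a0 ab) b1 (lexx _).
  have := var_haus_ge0 a a0; lra.
move=> /andP[x0 x1] /andP[y0 y1]; have [xy|/ltW yx] := lerP x y.
  by rewrite hausC; apply: lt.
exact: lt.
Qed.

Lemma haus_le_modulus (delta x y : R) : 0 <= x <= 1 -> 0 <= y <= 1 ->
  `|x - y| <= delta -> haus (F x) (F y) <= modulus haus F delta.
Proof. exact: (le_modulus _ _ _ haus_le_var1). Qed.

Lemma var_diff_le_modulus (delta a b : R) : 0 <= a -> a <= b -> b <= 1 ->
  b - a <= delta -> var_fun haus F b - var_fun haus F a
    <= modulus rdist (var_fun haus F) delta.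
Proof.
move=> a0 ab b1 bad; have b0 := le_trans a0 ab; have a1 := le_trans ab b1.
apply: le_trans (ler_norm _) _.
apply: (le_modulus rdist _ (var_fun haus F 1)).
- move=> x y /andP[x0 x1] /andP[y0 y1]; rewrite /rdist ler_norml.
  have := var_haus_ge0 x x0; have := var_haus_ge0 y y0.
  have := var_fun_le _ _ F_bv x 1 x0 x1 (lexx _).
  have := var_fun_le _ _ F_bv y 1 y0 y1 (lexx _).
  by move=> *; apply/andP; split; lra.
- by rewrite b0.
- by rewrite a0.
- by rewrite ger0_norm // subr_ge0.
Qed.

(** The detour is through the point [f k + t (f k.+1 - f k)], with
    [t = N x - k], where the polygonal curve through the chain passes at
    [x]. *)
Lemma chain_node_bernstein (C : R) (N : nat) (x : R) (f : nat -> 'rV[R]_n)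
    (k : nat) :
  bernstein_bound C -> (1 <= N)%N -> 0 <= x <= 1 ->
  metric_chain (fun i : 'I_N.+1 => F (i%:R / N%:R)) (fun i => f i) ->
  (k < N)%N -> k%:R <= N%:R * x <= k.+1%:R ->
  edistance (f k) (\sum_(i < N.+1) bernstein_basis N i x *: f i)
    <= modulus haus F (1 / N%:R)
       + 5 * C * modulus rdist (var_fun haus F) (Num.sqrt (x * (1 - x) / N%:R)).
Proof.
move=> hC N1 x01 chain kN kx; set W := modulus rdist _ _.
have N0 : 0 < N%:R :> R by rewrite ltr0n.
have step i : (i < N)%N ->
    edistance (f i.+1) (f i) <= haus (F (i.+1%:R / N%:R)) (F (i%:R / N%:R)).
  move=> iN; have iN1 : (i < N.+1)%N by exact: ltnW.
  pose A (i : 'I_N.+1) := F (i%:R / N%:R).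
  apply: (metric_chain_step _ _ _ A (fun i => f i) (Ordinal iN1)
    (Ordinal (iN : i.+1 < N.+1)%N)) => // j.
  by apply/F_compact/node01 => //; rewrite -ltnS.
apply: le_trans (edistance_triangle _ _ (f k + (N%:R * x - k%:R) *:
  (f k.+1 - f k)) _ _) _; apply: lerD.
  rewrite edistanceC /edistance addrAC subrr add0r enormZ.
  have /andP[kx1 kx2] := kx.
  rewrite ger0_norm ?subr_ge0 //.
  apply: le_trans (_ : enorm (f k.+1 - f k) <= _).
    by rewrite ler_piMl ?enorm_ge0 // lerBlDr nat1r.
  apply: le_trans (step k kN) _; apply: haus_le_modulus.
  - exact: node01.
  - by apply: node01 => //; exact: ltnW.
  - by rewrite -mulrBl -natr1 addrAC subrr add0r ger0_norm.
apply: le_trans (_ : 3 * C * W <= _).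
  apply: (bernstein_vector _ _ _ (var_fun haus F)) => //.
  - by move=> a b; exact: var_fun_le.
  - by move=> a b; exact: var_diff_le_modulus.
  - move=> i iN; apply: le_trans (step i iN) _; apply: haus_le_var_diff.
    + by rewrite divr_ge0.
    + by rewrite ler_pM2r ?invr_gt0 // ler_nat.
    + by case/andP: (@node01 R N i.+1 N1 iN).
have C0 := bernstein_bound_ge0 _ _ hC.
have W0 : 0 <= W.
  exact: osc_ge0 _ _ _ (var_diff_le_modulus _) (sqrtr_ge0 _).
by rewrite ler_wpM2r // ler_wpM2r // ler_nat.
Qed.

End SetValued.

Theorem corollary6p3 (R : realType) (n : nat) (C : R)
  (hC : forall f : R -> R, {within `[0, 1], continuous f} ->
    forall N : nat, (1 <= N)%N -> forall x : R, 0 <= x <= 1 ->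
      `|f x - bernstein N f x|
        <= C * modulus rdist f (Num.sqrt (x * (1 - x) / N%:R)))
  (F : R -> set 'rV[R]_n)
  (F_nonempty : forall x : R, 0 <= x <= 1 -> F x !=set0)
  (F_compact : forall x : R, 0 <= x <= 1 -> compact (F x))
  (F_continuous : continuous01 haus F)
  (F_bv : bounded_var haus F)
  (N : nat) (hN : (1 <= N)%N) (x : R) (hx : 0 <= x <= 1) :
  haus (metric_bernstein N F x) (F x)
    <= 2 * modulus haus F (1 / N%:R)
       + 5 * C * modulus rdist (var_fun haus F) (Num.sqrt (x * (1 - x) / N%:R)).
Proof.
have [k kN kx] := between_nodes _ _ _ hN hx.
have N0 : 0 < N%:R :> R by rewrite ltr0n.
have k01 : 0 <= (k%:R / N%:R : R) <= 1 by apply: node01 => //; exact: ltnW.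
have kxN : `|k%:R / N%:R - x| <= 1 / N%:R.
  rewrite -(ler_pM2l N0) -{1}(gtr0_norm N0) -normrM mulrBr.
  have NV (a : R) : N%:R * (a / N%:R) = a by rewrite mulrC divfK ?gt_eqF.
  rewrite !NV.
  have /andP[kx1 kx2] := kx; rewrite -natr1 in kx2.
  by rewrite ler_norml; apply/andP; split; lra.
have F_nodes i : (i <= N)%N ->
    compact (F (i%:R / N%:R)) /\ F (i%:R / N%:R) !=set0.
  by move=> iN; split; [apply: F_compact|apply: F_nonempty]; exact: node01.
have through p : F (k%:R / N%:R) p -> exists2 e, metric_bernstein N F x e &
    edistance p e <= modulus haus F (1 / N%:R)
       + 5 * C * modulus rdist (var_fun haus F) (Num.sqrt (x * (1 - x) / N%:R)).
  have kN' := ltnW kN.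
  move=> /(metric_chain_through _ _ _ (fun i => F (i%:R / N%:R)) _ _ kN' F_nodes).
  move=> [a chain ak]; exists (\sum_(i < N.+1) bernstein_basis N i x *: a i).
    by exists (fun i => a i).
  rewrite -ak; exact: (chain_node_bernstein F F_nonempty F_compact F_bv).
have near y z p : 0 <= y <= 1 -> 0 <= z <= 1 -> `|y - z| <= 1 / N%:R -> F y p ->
    exists2 q, F z q & edistance p q <= modulus haus F (1 / N%:R).
  move=> y01 z01 yz Fyp.
  have [q pq] := proj_nonempty _ _ _ p (F_compact z z01) (F_nonempty z z01).
  exists q; first by case: pq.
  apply: le_trans (proj_haus _ _ _ _ _ _ (F_compact y y01) Fyp pq) _.
  exact: haus_le_modulus.
apply: haus_le.
- have [p Fp] := F_nonempty _ k01; have [e Be _] := through p Fp; by exists e.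
- exact: F_nonempty.
- move=> _ [a chain <-].
  have Fa : F (k%:R / N%:R) (a (inord k)).
    by have := chain.1 (inord k); rewrite /= inordK // ltnS ltnW.
  have [q Fq aq] := near _ x _ k01 hx kxN Fa; exists q => //.
  have aE : (fun i : 'I_N.+1 => a (inord i)) = a.
    by apply/funext => i; rewrite inord_val.
  have chain' : metric_chain (fun i : 'I_N.+1 => F (i%:R / N%:R))
      (fun i => a (inord i)) by rewrite aE.
  have := chain_node_bernstein F F_nonempty F_compact F_bv C N x
    (fun i => a (inord i)) k hC hN hx chain' kN kx.
  under eq_bigr do rewrite inord_val.
  rewrite edistanceC => ea.
  apply: le_trans (edistance_triangle _ _ (a (inord k)) _ _) _.
  lra.
- move=> p Fp; have xkN : `|x - k%:R / N%:R| <= 1 / N%:R by rewrite distrC.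
  have [q Fq pq] := near x _ p hx k01 xkN Fp.
  have [e Be qe] := through q Fq; exists e => //.
  apply: le_trans (edistance_triangle _ _ q _ _) _; lra.
Qed.
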